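(* Let $f\in\mathbb{C}[x_0,\dots,x_n]$ be a polynomial with $(n+2)$ monomials, $$f=\sum_{j=1}^{n+2}m_j,\qquad m_j:=x^{\alpha_j}\ \text{ for } j\in[1,n+1],\qquad m_{n+2}:=\lambda\,x^{\alpha_{n+2}},\quad \lambda\in\mathbb{C}^*,$$ where $\alpha_1,\dots,\alpha_{n+2}\in\mathbb{N}^{n+1}$ are non zero. Assume the conditions: (C1) $\alpha_1,\dots,\alpha_{n+1}$ is a $\mathbb{Q}$-basis of $\mathbb{Q}^{n+1}$; (C2) the $(n+2,n+2)$ matrix $\tilde M$, obtained from the matrix $M$ with columns $\alpha_1,\dots,\alpha_{n+2}$ by adding a first line equal to $(1,\dots,1)$, has rank $n+2$. Let $d$ and $h$ be the positive integers and $r\in\mathbb{Z}^*$ the non zero integer attached to $\alpha_1,\dots,\alpha_{n+2}$ as defined in the context. Then for each $\beta\in\mathbb{N}^{n+1}$ there exist homogeneous elements $P_{d+h}$ and $P_d$ of $\mathcal{A}$, of respective degrees $d+h$ and $d$, which are products of homogeneous factors of degree $1$ of the form $a-\xi b$ with $\xi\in\mathbb{Q}$, such that $$\Big(P_{d+h}(a,b)-c\,\lambda^r\,P_d(a,b)\Big)[x^\beta dx]=0\quad\text{in } E_f[\lambda],\quad\text{where } c\in\mathbb{Q}^* .$$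
   Context: $\mathcal{A}:=\mathbb{C}\langle a,b\rangle$ with the commutation relation $ab-ba=b^2$, graded by total degree in $(a,b)$. $\Omega^p$ is the $\mathbb{C}[x_0,\dots,x_n]$-module of algebraic (polynomial) $p$-forms on $\mathbb{C}^{n+1}$, $\mathrm{Ker}(df)^n$ is the kernel of $df\wedge:\Omega^n\to\Omega^{n+1}$, and $E_f:=\Omega^{n+1}/d(\mathrm{Ker}(df)^n)$, a left $\mathcal{A}$-module where $a$ is multiplication by $f$ and $b[\omega]=[df\wedge u]$ with $u\in\Omega^n$, $du=\omega$. This structure of left $\mathcal{A}$-module is extended to $E_f[\lambda]:=E_f\otimes_{\mathbb{C}}\mathbb{C}[\lambda]$ by asking that $a$ and $b$ are $\mathbb{C}[\lambda]$-linear. Here $dx=dx_0\wedge\dots\wedge dx_n$. Definition of $d,h,r$: by (C1) write $\alpha_{n+2}=\sum_{j=1}^{n+1}\rho_j\alpha_j$ with $\rho_j\in\mathbb{Q}$, and put $J_+=\{j\in[1,n+1]:\rho_j>0\}$, $J_-=\{j\in[1,n+1]:\rho_j<0\}$. Let $|r|$ be the smallest positive integer such that $p_j:=|r|\rho_j$ is an integer for every $j\in[1,n+1]$. Then $d+h$ and $d$ are respectively the supremum and the infimum of the two numbers $|r|+\sum_{j\in J_-}(-p_j)$ and $\sum_{j\in J_+}p_j$; both $d$ and $h$ are positive ($h\neq0$ by (C2)). The relation between monomials $m_{n+2}^{|r|}\prod_{j\in J_-}m_j^{-p_j}=\lambda^{|r|}\prod_{j\in J_+}m_j^{p_j}$ is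 rewritten $m^\Delta=\lambda^r m^\delta$ with $\Delta,\delta\in\mathbb{N}^{n+2}$ of respective lengths (sums of components) $d+h$ and $d$; this defines the sign of $r\in\mathbb{Z}^*$. *)

(* Defs.v *)
From HB Require Import structures.
From mathcomp Require Import all_boot all_order all_algebra.
From mathcomp Require Import finmap.
From mathcomp Require Import boolp reals.
From mathcomp Require classical_sets.
From mathcomp Require Import complex.
From mathcomp Require monalg.
From mathcomp Require Import mpoly.

Set Implicit Arguments.
Unset Strict Implicit.
Unset Printing Implicit Defensive.

Import GRing.Theory Num.Theory.
Local Open Scope ring_scope.
Local Open Scope quotient_scope.

Record submodule (K : pzRingType) (V : lmodType K) := Submodule {
  submodule_mem :> {pred V};
  submoduleP : submod_closed submodule_mem }.

HB.instance Definition _ (K : pzRingType) (V : lmodType K) (S : submodule V) :=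
  GRing.isZmodClosed.Build V (submodule_mem S)
    (GRing.submod_closedB (submoduleP S)).

Section ModuleQuotient.
Variables (K : pzRingType) (V : lmodType K) (S : submodule V).

Lemma submoduleZ (c : K) (x : V) : x \in S -> c *: x \in S.
Proof.
by case: (submoduleP S) => S0 SL Sx; rewrite -[c *: x]addr0; apply: SL.
Qed.

Definition modquot := Quotient.quot (submodule_mem S).
HB.instance Definition _ := GRing.Zmodule.on modquot.
HB.instance Definition _ := EqQuotient.on modquot.

Definition modquot_scale (c : K) (x : modquot) : modquot :=
  \pi_modquot (c *: repr x).

Lemma modquot_eqP (x y : V) :
  reflect (\pi_modquot x = \pi_modquot y) (x - y \in S).
Proof. rewrite Quotient.idealrBE; exact: eqP. Qed.

Lemma modquot_reprP (x : V) : repr (\pi_modquot x) - x \in S.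
Proof. by apply/modquot_eqP; rewrite reprK. Qed.

Lemma modquot_piD (x y : V) :
  \pi_modquot (x + y) = \pi_modquot x + \pi_modquot y.
Proof. exact: (Quotient.pi_add (submodule_mem S) x y). Qed.

Lemma modquot_piZ (c : K) (x : V) :
  modquot_scale c (\pi_modquot x) = \pi_modquot (c *: x).
Proof. by apply/modquot_eqP; rewrite -scalerBr submoduleZ ?modquot_reprP. Qed.

Fact modquot_scaleA c d x :
  modquot_scale c (modquot_scale d x) = modquot_scale (c * d) x.
Proof. by rewrite -[x]reprK !modquot_piZ scalerA ?reprK. Qed.

Fact modquot_scale1 : left_id 1 modquot_scale.
Proof. by move=> x; rewrite -[x in LHS]reprK modquot_piZ scale1r reprK. Qed.

Fact modquot_scaleDr : right_distributive modquot_scale +%R.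
Proof.
move=> c x y; rewrite -[x]reprK -[y]reprK -modquot_piD !modquot_piZ.
by rewrite scalerDr modquot_piD.
Qed.

Fact modquot_scaleDl x : {morph modquot_scale^~ x : c d / c + d}.
Proof.
by move=> c d; rewrite -[x]reprK !modquot_piZ scalerDl modquot_piD.
Qed.

HB.instance Definition _ := GRing.Zmodule_isLmodule.Build K modquot
  modquot_scaleA modquot_scale1 modquot_scaleDr modquot_scaleDl.

End ModuleQuotient.

Section OperatorAlgebra.
Import monalg.
Variable C : fieldType.

(* Noncommutative polynomials in two letters: [true] is a, [false] is b. *)
Definition freealg := {malg C[{fmonom bool}]}.
HB.instance Definition _ := GRing.Lalgebra.on freealg.

Definition free_a : freealg := << fmu true >>.
Definition free_b : freealg := << fmu false >>.
Definition commrel : freealg :=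
  free_a * free_b - free_b * free_a - free_b ^+ 2.

Definition commideal : {pred freealg} := fun x => `[<
  exists s : seq (freealg * freealg),
    x = \sum_(u <- s) u.1 * commrel * u.2 >].

Fact commideal_submod : submod_closed commideal.
Proof.
split=> [|c x y /asboolP[s ->] /asboolP[t ->]]; apply/asboolP.
  by exists [::]; rewrite big_nil.
exists ([seq (c *: u.1, u.2) | u <- s] ++ t).
rewrite big_cat big_map scaler_sumr; congr (_ + _).
by apply: eq_bigr => u _; rewrite !scalerAl.
Qed.
Definition comm_submodule : submodule freealg := Submodule commideal_submod.

Fact commideal_mulr x y : x \in commideal -> x * y \in commideal.
Proof.
move=> /asboolP[s ->]; apply/asboolP.
exists [seq (u.1, u.2 * y) | u <- s].
by rewrite big_map mulr_suml; apply: eq_bigr => u _; rewrite !mulrA.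
Qed.

Fact commideal_mull x y : x \in commideal -> y * x \in commideal.
Proof.
move=> /asboolP[s ->]; apply/asboolP.
exists [seq (y * u.1, u.2) | u <- s].
by rewrite big_map mulr_sumr; apply: eq_bigr => u _; rewrite !mulrA.
Qed.

Definition abalg := modquot comm_submodule.
HB.instance Definition _ := GRing.Lmodule.on abalg.
HB.instance Definition _ := EqQuotient.on abalg.

Definition abalg_one : abalg := \pi_abalg 1.
Definition abalg_mul (P Q : abalg) : abalg := \pi_abalg (repr P * repr Q).

Lemma abalg_piM (x y : freealg) :
  abalg_mul (\pi_abalg x) (\pi_abalg y) = \pi_abalg (x * y).
Proof.
apply/modquot_eqP; set x' := repr _; set y' := repr _.
have -> : x' * y' - x * y = (x' - x) * y' + x * (y' - y).
  by rewrite mulrBl mulrBr addrA subrK.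
by apply: rpredD; [apply: commideal_mulr | apply: commideal_mull];
  exact: modquot_reprP.
Qed.

Fact abalg_mulA : associative abalg_mul.
Proof.
elim/quotW=> x; elim/quotW=> y; elim/quotW=> z.
by rewrite (abalg_piM y z) (abalg_piM x y) !abalg_piM mulrA.
Qed.

Fact abalg_mul1 : left_id abalg_one abalg_mul.
Proof. by elim/quotW=> x; rewrite abalg_piM mul1r. Qed.

Fact abalg_mulr1 : right_id abalg_one abalg_mul.
Proof. by elim/quotW=> x; rewrite abalg_piM mulr1. Qed.

Fact abalg_mulDl : left_distributive abalg_mul +%R.
Proof.
elim/quotW=> x; elim/quotW=> y; elim/quotW=> z.
rewrite (abalg_piM x z) (abalg_piM y z) -[_ + \pi y]modquot_piD abalg_piM.
by rewrite mulrDl modquot_piD.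
Qed.

Fact abalg_mulDr : right_distributive abalg_mul +%R.
Proof.
elim/quotW=> x; elim/quotW=> y; elim/quotW=> z.
rewrite (abalg_piM x y) (abalg_piM x z) -[_ + \pi z]modquot_piD abalg_piM.
by rewrite mulrDr modquot_piD.
Qed.

HB.instance Definition _ := GRing.Zmodule_isPzRing.Build abalg
  abalg_mulA abalg_mul1 abalg_mulr1 abalg_mulDl abalg_mulDr.

Definition ab_a : abalg := \pi_abalg free_a.
Definition ab_b : abalg := \pi_abalg free_b.

Lemma ab_comm : ab_a * ab_b - ab_b * ab_a = ab_b ^+ 2.
Proof.
have -> : ab_a * ab_b - ab_b * ab_a =
    \pi_abalg (free_a * free_b - free_b * free_a).
  rewrite -scaleN1r modquot_piD -[- (_ * _)]scaleN1r -modquot_piZ.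
  by rewrite -!abalg_piM.
rewrite expr2 [RHS]abalg_piM; apply/modquot_eqP; rewrite -expr2.
by apply/asboolP; exists [:: (1, 1)]; rewrite big_seq1 mul1r mulr1.
Qed.

Definition homogeneous (k : nat) (P : abalg) : Prop :=
  exists2 g : freealg, \pi_abalg g = P &
    forall w, monalg.mcoeff w g != 0 -> fdeg w = k.

Definition linear_product (k : nat) (P : abalg) : Prop :=
  exists xi : k.-tuple rat, P = \prod_(t <- xi) (ab_a - ratr t *: ab_b).

Definition word_act (E : Type) (ua ub : E -> E) (w : {fmonom bool}) (x : E) :=
  foldr (fun l : bool => if l then ua else ub) x w.

(* The value P(ua, ub) x; coefficients act through [iota].  It does not depend
   on the representative of P when ua, ub are K-linear and
   ua ub - ub ua = ub ^ 2. *)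
Definition ab_act (K : pzRingType) (iota : {rmorphism C -> K})
    (E : lmodType K) (ua ub : E -> E) (P : abalg) (x : E) : E :=
  \sum_(w <- monalg.msupp (repr P))
    iota (monalg.mcoeff w (repr P)) *: word_act ua ub w x.

End OperatorAlgebra.

(* Forms have coefficients in K[x_0, ..., x_n] and d is K-linear; E_f is the
   case where K is the field of complex numbers C, and E_f[lambda] the case
   K = C[lambda], where lambda is a constant for d. *)
Section BrieskornModule.
Variables (K : comNzRingType) (n : nat).

Definition multiindex (p : nat) := {I : {set 'I_n.+1} | #|I| == p}.

(* A form is given by its coefficients on the dx_I, where dx_I is the wedge
   product of the dx_i, i in I, in increasing order. *)
Definition form (p : nat) := {ffun multiindex p -> {mpoly K[n.+1]}}.
HB.instance Definition _ p := GRing.Lmodule.on (form p).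

Definition fcoef p (w : form p) (I : {set 'I_n.+1}) : {mpoly K[n.+1]} :=
  if insub I is Some J then w J else 0.

(* dx_I /\ dx_J = wsign I J * dx_(I :|: J) for disjoint I and J *)
Definition wsign (I J : {set 'I_n.+1}) : {mpoly K[n.+1]} :=
  (-1) ^+ #|[set ij in setX I J | (ij.2 < ij.1)%N]|.

Definition wedge p q (v : form p) (w : form q) : form (p + q) :=
  [ffun L : multiindex (p + q) =>
     \sum_(I : multiindex p | val I \subset val L)
       wsign (val I) (val L :\: val I) * v I * fcoef w (val L :\: val I)].

Definition dform p (w : form p) : form p.+1 :=
  [ffun L : multiindex p.+1 => \sum_(i in val L)
     wsign [set i] (val L :\ i) * mderiv i (fcoef w (val L :\ i))].

Definition form0 (g : {mpoly K[n.+1]}) : form 0 := [ffun=> g].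

Definition mulform p (g : {mpoly K[n.+1]}) (w : form p) : form p :=
  [ffun I => g * w I].

Definition monvol (beta : 'X_{1..n.+1}) : form n.+1 := [ffun=> 'X_[beta]].

Lemma fcoef_linear p I : linear (@fcoef p ^~ I).
Proof.
move=> c u v; rewrite /fcoef; case: insubP => [J _ _|_].
  by rewrite !ffunE.
by rewrite scaler0 addr0.
Qed.

Lemma wedge_linear p q (v : form p) : linear (@wedge p q v).
Proof.
move=> c u w; apply/ffunP=> L; rewrite !ffunE scaler_sumr -big_split /=.
by apply: eq_bigr => I _; rewrite fcoef_linear mulrDr -scalerAr.
Qed.

Lemma dform_linear p : linear (@dform p).
Proof.
move=> c u w; apply/ffunP=> L; rewrite !ffunE scaler_sumr -big_split /=.
apply: eq_bigr => i _.
by rewrite fcoef_linear mderivD mderivZ mulrDr -scalerAr.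
Qed.

Variable f : {mpoly K[n.+1]}.

Definition dfwedge (u : form n) : form n.+1 := wedge (dform (form0 f)) u.

Definition dKer : {pred form n.+1} :=
  fun w => `[< exists2 u : form n, dfwedge u = 0 & dform u = w >].

Fact dKer_submod : submod_closed dKer.
Proof.
split=> [|c x y /asboolP[u u0 <-] /asboolP[v v0 <-]]; apply/asboolP.
  have lin0 p q (g : form p -> form q) : linear g -> g 0 = 0.
    by move=> gl; rewrite -[0 in LHS](subrr 0) addrC -scaleN1r gl scaleN1r addNr.
  exists 0; first exact: (lin0 _ _ _ (wedge_linear (dform (form0 f)))).
  exact: (lin0 _ _ _ (@dform_linear n)).
exists (c *: u + v); last by rewrite dform_linear.
by rewrite /dfwedge wedge_linear [X in c *: X]u0 [X in _ + X]v0 scaler0 addr0.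
Qed.
Definition dKer_submodule : submodule (form n.+1) := Submodule dKer_submod.

Definition brieskorn := modquot dKer_submodule.
HB.instance Definition _ := GRing.Lmodule.on brieskorn.
HB.instance Definition _ := EqQuotient.on brieskorn.

Definition brieskorn_class (w : form n.+1) : brieskorn := \pi_brieskorn w.

(* For n > 0 the condition at the origin does not affect [df /\ u] in the
   quotient; for n = 0 it fixes the constant of integration, on which
   [df /\ u] depends. *)
Definition primitive (w : form n.+1) : form n :=
  classical_sets.xget 0
    (fun u : form n => dform u = w /\ forall I, (u I)@_0%MM = 0).

Definition act_a (x : brieskorn) : brieskorn :=
  brieskorn_class (mulform f (repr x)).
Definition act_b (x : brieskorn) : brieskorn :=
  brieskorn_class (dfwedge (primitive (repr x))).

Definition brieskorn_act (C : fieldType) (iota : {rmorphism C -> K}) :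
    abalg C -> brieskorn -> brieskorn :=
  ab_act iota act_a act_b.

End BrieskornModule.
Arguments monvol {K n} beta.

Section Exponents.
Variables (n : nat) (alpha : 'I_n.+2 -> 'X_{1..n.+1}).

(* alpha_1, ..., alpha_{n+1} are the [alpha (lift ord_max j)], j : 'I_n.+1, and
   alpha_{n+2} is [alpha ord_max]. *)
Definition exponent_vec (j : 'I_n.+2) : 'cV[rat]_n.+1 :=
  \col_i (alpha j i)%:R.

Definition first_exponents : (n.+1).-tuple 'cV[rat]_n.+1 :=
  [tuple exponent_vec (lift ord_max j) | j < n.+1].

Definition exponent_mx : 'M[rat]_(n.+1, n.+2) :=
  \matrix_(i, j) (alpha j i)%:R.

Definition exponent_mx1 : 'M[rat]_(1 + n.+1, n.+2) :=
  col_mx (const_mx 1) exponent_mx.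

Definition rho (j : 'I_n.+1) : rat :=
  coord first_exponents j (exponent_vec ord_max).

Fact abs_r_exists :
  exists N, (0 < N)%N && [forall j, N%:R * rho j \is a Num.int].
Proof.
exists (\prod_j `|denq (rho j)|)%N; apply/andP; split.
  by rewrite prodn_gt0 // => j; rewrite absz_gt0 denq_neq0.
apply/forallP=> j; rewrite (bigD1 j) //= natrM mulrAC.
apply: rpredM; last exact: natr_int.
rewrite -[X in _ * X]divq_num_den mulrCA; apply: rpredM; first exact: intr_int.
have den0 : (denq (rho j))%:~R != 0 :> rat by rewrite intr_eq0 denq_neq0.
suff -> : `|denq (rho j)|%:R = (denq (rho j))%:~R :> rat by rewrite divff.
by rewrite -[in RHS](gtz0_abs (denq_gt0 _)) pmulrn.
Qed.

Definition abs_r : nat := ex_minn abs_r_exists.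

(* [abs_r%:R * rho j] is an integer, hence equal to its numerator. *)
Definition pcoef (j : 'I_n.+1) : int := numq (abs_r%:R * rho j).

(* Exponents of m_1, ..., m_{n+2} on both sides of
   m_{n+2}^|r| \prod_(J_-) m_j^(- p_j) = lambda^|r| \prod_(J_+) m_j^(p_j) *)
Definition lhs_exp (j : 'I_n.+2) : nat :=
  if unlift ord_max j is Some k
  then (if rho k < 0 then `|pcoef k|%N else 0) else abs_r.

Definition rhs_exp (j : 'I_n.+2) : nat :=
  if unlift ord_max j is Some k
  then (if 0 < rho k then `|pcoef k|%N else 0) else 0.

Definition len (e : 'I_n.+2 -> nat) : nat := \sum_j e j.

Definition lhs_longer : bool := (len rhs_exp < len lhs_exp)%N.

Definition Delta : 'I_n.+2 -> nat := if lhs_longer then lhs_exp else rhs_exp.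
Definition delta : 'I_n.+2 -> nat := if lhs_longer then rhs_exp else lhs_exp.

Definition deg_d : nat := len delta.
Definition deg_h : nat := len Delta - len delta.
Definition exp_r : int := if lhs_longer then abs_r%:Z else - abs_r%:Z.

Definition fpoly (K : comNzRingType) (lambda : K) : {mpoly K[n.+1]} :=
  \sum_(j < n.+1) 'X_[alpha (lift ord_max j)] + lambda *: 'X_[alpha ord_max].

End Exponents.

(* Main.v *)
Require Import Defs.
From HB Require Import structures.
From mathcomp Require Import all_boot all_order all_algebra.
From mathcomp Require Import finmap boolp.
From mathcomp Require Import reals complex mpoly.
From mathcomp Require monalg classical_sets.

(** Contracting with the Euler fields [x_i d/dx_i] gives, for every monomial
    form [w = x^gamma dx], the relations
    [sum_j alpha_(j,i) m_j w = (gamma_i + 1) b w] in the Brieskorn module, one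
    for each variable, and [sum_j m_j w = a w] by definition of [a]. These are
    [n + 2] linear equations for the [n + 2] classes [m_j w], whose matrix is
    exactly the invertible matrix of condition (C2). Solving them
    ([term_monomial_class]) expresses [m_j w] as [(s_j a + t_j b) w], with [s_j]
    and [t_j] rational and [s_j] independent of [gamma]. The vector [s] is
    determined by [sum_j s_j alpha_j = 0] and [sum_j s_j = 1], so by (C1)
    [s_(n+2) <> 0] and [s_j = - rho_j s_(n+2)] ([a_coef_lift]). Multiplying a
    monomial form by a term [m_j] that occurs in the monomial relation is
    therefore a nonzero rational times the action of some [a - xi b].

    Multiplying [x^beta dx] by the terms of [m^Delta] one after the other, and
    likewise for [m^delta], produces products [P] and [Q] of linear factors
    ([prod_term_class]), and [m^Delta = lambda^r m^delta] becomes the required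
    identity ([two_term_relation]). The factors depend on the order in which the
    terms are taken, but any order yields such a relation.

    The value of an element of the operator algebra is computed from an
    arbitrary representative in the free algebra, and [b] from an arbitrary
    representative of a class and an arbitrary primitive of it. What makes the
    computation legitimate is that [a] and [b] are linear on the Brieskorn
    module and satisfy [a b - b a = b^2]. For [b] this rests on the Poincare
    lemma in degree [n]: two primitives [u], [u'] of a top form differ by an
    exact form [d y], and [df /\ d y = - d (df /\ y)] with
    [df /\ (df /\ y) = 0]. In one variable there is no [y]; there the constant
    of integration is fixed, and [df] is a nonzero multiple of [dx].

    Forms of degree [n] and [n + 1] are handled as vector fields and
    polynomials, so that [d] is the divergence and [df /\] the derivation of [f]
    along the field. Everything is proved over a domain [K] that receives the
    field [C], which treats a complex [lambda] and an indeterminate [lambda] at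
    once. *)

Set Implicit Arguments.
Unset Strict Implicit.
Unset Printing Implicit Defensive.

Import Order.TTheory GRing.Theory Num.Theory.
Local Open Scope ring_scope.
Local Open Scope quotient_scope.

(** * Forms of degree n and n+1 as vector fields and functions *)

Section VectorFields.
Variables (K : comNzRingType) (n : nat).
Local Notation poly := {mpoly K[n.+1]}.
Local Notation vfield := ('I_n.+1 -> poly).

Definition divergence (U : vfield) : poly := \sum_i mderiv i (U i).

Definition derivation (f : poly) (U : vfield) : poly :=
  \sum_i mderiv i f * U i.

(** The sign is that of [dx_i /\ dx_I] for [I] the complement of [i], so that
    [u] is the contraction of the volume form with its vector field. *)
Definition form_vfield (u : Defs.form K n n) : vfield :=
  fun i => (-1) ^+ i * fcoef u [set~ i].

Definition vfield_form (U : vfield) : Defs.form K n n :=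
  [ffun I : multiindex n n =>
     \sum_(i : 'I_n.+1 | val I == [set~ i]) (-1) ^+ i * U i].

Definition top_form (g : poly) : Defs.form K n n.+1 := [ffun=> g].

Lemma wsign_setC1 (i : 'I_n.+1) : wsign K [set i] [set~ i] = (-1) ^+ i.
Proof.
rewrite /wsign; congr (_ ^+ _).
have -> : [set ij in setX [set i] [set~ i] | (ij.2 < ij.1)%N] =
          [set (i, j) | j in [set j : 'I_n.+1 | (j < i)%N]].
  apply/setP=> -[k j]; rewrite !inE /=; apply/idP/imsetP => [|[l]].
    by case/andP=> /andP[/eqP -> _] lt_ji; exists j; rewrite ?inE.
  by rewrite inE => lt_li [-> ->]; rewrite eqxx -val_eqE ltn_eqF.
rewrite card_imset => [|j k [] //].
rewrite cardsE -sum1_card (eq_bigl (fun j : 'I_n.+1 => (j < i)%N)) //.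
by rewrite (big_ord_narrow (ltnW (ltn_ord i))) sum1_card card_ord.
Qed.

Lemma top_index (L : multiindex n n.+1) : val L = setT.
Proof.
by apply/eqP; rewrite eqEcard subsetT cardsT card_ord (eqP (valP L)) /=.
Qed.

Lemma top_formP (w : Defs.form K n n.+1) : exists g, w = top_form g.
Proof.
have cT : #|[set: 'I_n.+1]| == n.+1 by rewrite cardsT card_ord.
exists (w (Sub setT cT)); apply/ffunP=> L; rewrite ffunE; congr (w _).
by apply: val_inj; rewrite top_index.
Qed.

Lemma top_form_inj : injective top_form.
Proof.
have cT : #|[set: 'I_n.+1]| == n.+1 by rewrite cardsT card_ord.
by move=> g h /ffunP /(_ (Sub setT cT)); rewrite !ffunE.
Qed.

Lemma vfield_formK U : form_vfield (vfield_form U) =1 U.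
Proof.
move=> i; have ci : #|[set~ i]| == n by rewrite cardsC1 card_ord.
rewrite /form_vfield /fcoef (insubT (fun I : {set 'I_n.+1} => #|I| == n) ci).
rewrite ffunE /= (big_pred1 i) => [|j]; last first.
  by rewrite eq_sym (inj_eq (@setC_inj _)) (inj_eq (@set1_inj _)).
by rewrite mulrA -expr2 sqrr_sign mul1r.
Qed.

Lemma dform_divergence u : dform u = top_form (divergence (form_vfield u)).
Proof.
apply/ffunP=> L; rewrite !ffunE top_index.
apply: eq_big => [i|i _]; first by rewrite inE.
have -> : setT :\ i = [set~ i] by rewrite setTD.
rewrite wsign_setC1 /form_vfield -signr_odd.
by case: (odd i); rewrite ?expr0 ?mul1r // expr1 !mulN1r mderivN.
Qed.

Lemma dfwedge_derivation f u :
  dfwedge f u = top_form (derivation f (form_vfield u)).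
Proof.
have c1 (i : 'I_n.+1) : #|[set i]| == 1%N by rewrite cards1.
apply/ffunP=> L; rewrite !ffunE.
(* The 1-element sets of indices are the singletons. *)
rewrite (reindex_onto (fun i : 'I_n.+1 => Sub [set i] (c1 i) : multiindex n 1)
          (fun I => odflt ord0 [pick i in val I])) /=; last first.
  move=> I _; apply: val_inj => /=; have /cards1P[i Ii] := valP I.
  by rewrite Ii; case: pickP => [j|/(_ i)]; rewrite inE ?eqxx // => /eqP->.
apply: eq_big => [i|i _].
  rewrite top_index subsetT /=.
  by case: pickP => [j|/(_ i)]; rewrite inE ?eqxx //.
rewrite top_index setTD wsign_setC1 ffunE /= big_set1 setDv.
have -> : wsign K [set i] set0 = 1.
  rewrite /wsign (_ : [set _ in _ | _] = set0) ?cards0 ?expr0 //.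
  by apply/setP=> -[k j]; rewrite !inE /= andbF.
have c0 : #|set0 : {set 'I_n.+1}| == 0%N by rewrite cards0.
rewrite /fcoef (insubT (fun I : {set 'I_n.+1} => #|I| == 0%N) c0) ffunE mul1r.
by rewrite /form_vfield -/(fcoef u [set~ i]) -mulrA mulrCA.
Qed.

End VectorFields.

(** * The Poincare lemma for polynomial vector fields *)

Section Poincare.
Variables (C : numFieldType) (K : comNzRingType) (iota : {rmorphism C -> K}).
Variable n : nat.
Local Notation poly := {mpoly K[n.+1]}.
Local Notation vfield := ('I_n.+1 -> poly).

Lemma iota_natV k : (0 < k)%N -> iota k%:R^-1 * k%:R = 1.
Proof.
move=> k_gt0; rewrite -(rmorph_nat iota) -rmorphM mulVf ?rmorph1 //.
by rewrite pnatr_eq0 -lt0n.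
Qed.

(** The inverse of [k + E], where [E] is the Euler operator, which multiplies a
    monomial by its degree. For [k = 0] the constant term is sent to [0]. *)
Definition euler_inv (k : nat) (g : poly) : poly :=
  \sum_(m <- msupp g) (iota (k + mdeg m)%:R^-1 * g@_m) *: 'X_[m].

Lemma mcoeff_euler_inv k g m :
  (euler_inv k g)@_m = iota (k + mdeg m)%:R^-1 * g@_m.
Proof.
rewrite /euler_inv raddf_sum /=.
rewrite (eq_bigr (fun m' =>
    if m' == m then iota (k + mdeg m)%:R^-1 * g@_m else 0)).
  have [m_g|/memN_msupp_eq0 ->] := boolP (m \in msupp g).
    rewrite (bigD1_seq m) ?msupp_uniq //= eqxx big1 ?addr0 // => i.
    by move/negPf->.
  by rewrite big1 ?mulr0 // => m' _; case: ifP; rewrite ?mulr0.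
move=> m' _; rewrite mcoeffZ mcoeffX.
by case: eqP => [->|]; rewrite ?mulr1 ?mulr0.
Qed.

Lemma mderiv_euler_inv k i g :
  mderiv i (euler_inv k g) = euler_inv k.+1 (mderiv i g).
Proof.
apply/mpolyP=> m; rewrite mcoeff_deriv !mcoeff_euler_inv mcoeff_deriv.
by rewrite mdegD mdeg1 addn1 addnS addSn mulrnAr.
Qed.

Lemma euler_inv_sum k (I : finType) (F : I -> poly) :
  euler_inv k (\sum_i F i) = \sum_i euler_inv k (F i).
Proof.
apply/mpolyP=> m; rewrite mcoeff_euler_inv !raddf_sum /= mulr_sumr.
by apply: eq_bigr => i _; rewrite mcoeff_euler_inv.
Qed.

Lemma euler_inv0 k : euler_inv k 0 = 0.
Proof. by rewrite /euler_inv msupp0 big_nil. Qed.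

(** The divergence of [g] times the position field is [(n + 1 + E) g]. *)
Lemma mcoeff_divergence_position (g : poly) m :
  (divergence (fun i => 'X_i * g))@_m = g@_m *+ (n.+1 + mdeg m).
Proof.
rewrite /divergence raddf_sum /=.
rewrite (eq_bigr (fun i => g@_m + g@_m *+ m i)) => [|i _].
  by rewrite big_split /= sumr_const card_ord sumrMnr -mulrnDr mdegE.
by rewrite mcoeff_deriv addmC mulrC mcoeffMX mulrS.
Qed.

(** A radial field, obtained by inverting [n + 1 + E]. *)
Definition primitive_field (g : poly) : vfield :=
  fun i => 'X_i * euler_inv n.+1 g.

Lemma mcoeff0_mulX (i : 'I_n.+1) (g : poly) : ('X_i * g)@_0%MM = 0.
Proof. by rewrite rmorphM /= mcoeffX -mdeg_eq0 mdeg1 mul0r.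
Qed.

Lemma divergence_primitive_field g : divergence (primitive_field g) = g.
Proof.
apply/mpolyP=> m; rewrite mcoeff_divergence_position mcoeff_euler_inv.
by rewrite -[LHS]mulr_natr mulrAC iota_natV ?mul1r // addSn.
Qed.

(** The antisymmetric tensor that the radial homotopy operator attaches to [V];
    in terms of forms, a primitive of the closed [n]-form of [V]. *)
Definition potential (V : vfield) (i j : 'I_n.+1) : poly :=
  'X_i * euler_inv n (V j) - 'X_j * euler_inv n (V i).

(** The divergence of [V_i] vanishes, and commuting [x_j] past it leaves a
    single [euler_inv n (V j)]; so the divergence of the [j]-th column is
    [n + E] applied to [euler_inv n (V j)]. Only constants for [n = 0] are
    lost. *)
Lemma divergence_potential V j :
    divergence V = 0 -> (n = 0%N -> forall i, (V i)@_0%MM = 0) ->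
  divergence (potential V ^~ j) = V j.
Proof.
move=> divV V0; rewrite /divergence.
under eq_bigr => i _ do rewrite mderivB.
rewrite sumrB; set s := (X in _ - X).
have -> : s = euler_inv n (V j).
  rewrite {}/s; under eq_bigr => i _ do rewrite mderivM mderiv_euler_inv.
  rewrite big_split /= -mulr_sumr -euler_inv_sum -/(divergence V) divV.
  rewrite euler_inv0 mulr0 addr0 (bigD1 j) //= big1 ?addr0 => [|i /negPf ne_ij].
    rewrite mderivX mnm1E eqxx scale1r (_ : U_(j) - U_(j) = 0)%MM.
      by rewrite mpolyX0 mul1r.
    by apply/mnmP=> k; rewrite mnmBE mnm0E subnn.
  by rewrite mderivX mnm1E eq_sym ne_ij scale0r mul0r.
apply/mpolyP=> m; rewrite mcoeffB mcoeff_divergence_position.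
rewrite addSn mulrS addrAC subrr add0r mcoeff_euler_inv.
have [nm0|nm_gt0] := posnP (n + mdeg m).
  move/eqP: (nm0); rewrite addn_eq0 => /andP[/eqP n0].
  by rewrite mdeg_eq0 => /eqP ->; rewrite V0 // mulr0 mul0rn.
by rewrite -[LHS]mulr_natr mulrAC iota_natV ?mul1r.
Qed.

Lemma potential_symmetric_eq0 V (h : 'I_n.+1 -> 'I_n.+1 -> poly) :
  (forall i j, h i j = h j i) ->
  \sum_i \sum_j potential V i j * h i j = 0.
Proof.
move=> hC; under eq_bigr => i _ do under eq_bigr => j _ do rewrite mulrBl.
under eq_bigr => i _ do rewrite sumrB.
rewrite sumrB [X in X - _]exchange_big /=; apply/eqP; rewrite subr_eq0.
by apply/eqP; apply: eq_bigr => i _; apply: eq_bigr => j _; rewrite hC.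
Qed.

(** In terms of forms: if [v = d y] then [df /\ v] is, up to sign, the
    differential of [df /\ y], which is killed by [df /\]. With the
    antisymmetric potential [A] of [V] this reads [Z_i = sum_j A_ij f_j]; both
    [f_i f_j] and the Hessian of [f] are symmetric, so they cancel against
    [A]. *)
Lemma derivation_closed f V :
    divergence V = 0 -> (n = 0%N -> forall i, (V i)@_0%MM = 0) ->
  exists2 Z : vfield, derivation f Z = 0 & divergence Z = derivation f V.
Proof.
move=> divV V0; pose A := potential V.
exists (fun i => \sum_j A i j * mderiv j f).
  rewrite -[RHS](potential_symmetric_eq0 V
    (h := fun i j => mderiv i f * mderiv j f)) => [|i j]; last exact: mulrC.
  apply: eq_bigr => i _; rewrite mulr_sumr; apply: eq_bigr => j _.
  exact: mulrCA.
rewrite /divergence /derivation.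
under eq_bigr => i _ do rewrite raddf_sum /=.
under eq_bigr => i _ do under eq_bigr => j _ do rewrite mderivM.
under eq_bigr => i _ do rewrite big_split /=.
rewrite big_split /= (potential_symmetric_eq0 V
  (h := fun i j => mderiv i (mderiv j f))) => [|i j]; last exact: mderiv_comm.
rewrite addr0 exchange_big /=; apply: eq_bigr => j _.
by rewrite -mulr_suml -/(divergence (A ^~ j)) divergence_potential // mulrC.
Qed.

End Poincare.

(** * The operators a and b on the Brieskorn module *)

Section BrieskornOperators.
Variables (C : numFieldType) (K : comNzRingType) (iota : {rmorphism C -> K}).
Variables (n : nat) (f : {mpoly K[n.+1]}).
Local Notation poly := {mpoly K[n.+1]}.
Local Notation vfield := ('I_n.+1 -> poly).

Lemma divergenceZD c (U V : vfield) :
  divergence (fun i => c *: U i + V i) = c *: divergence U + divergence V.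
Proof.
rewrite /divergence scaler_sumr -big_split /=.
by apply: eq_bigr => i _; rewrite mderivD mderivZ.
Qed.

Lemma derivationZD c (U V : vfield) :
  derivation f (fun i => c *: U i + V i) = c *: derivation f U + derivation f V.
Proof.
rewrite /derivation scaler_sumr -big_split /=.
by apply: eq_bigr => i _; rewrite mulrDr -scalerAr.
Qed.

Lemma eq_derivation (U V : vfield) :
  U =1 V -> derivation f U = derivation f V.
Proof. by move=> eUV; apply: eq_bigr => i _; rewrite eUV. Qed.

Lemma eq_divergence (U V : vfield) : U =1 V -> divergence U = divergence V.
Proof. by move=> eUV; apply: eq_bigr => i _; rewrite eUV. Qed.

Definition poly_class (g : poly) : brieskorn f :=
  brieskorn_class f (top_form g).

Lemma poly_classP x : exists g, x = poly_class g.
Proof.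
have [g reprE] := top_formP (repr x).
by exists g; rewrite /poly_class -reprE; rewrite /brieskorn_class reprK.
Qed.

Lemma poly_class_linear : linear poly_class.
Proof.
move=> c g h; rewrite /poly_class /brieskorn_class.
have -> : top_form (c *: g + h) = c *: top_form g + top_form h.
  by apply/ffunP=> L; rewrite !ffunE.
by rewrite modquot_piD -modquot_piZ.
Qed.

HB.instance Definition _ :=
  GRing.isLinear.Build K poly (brieskorn f) _ poly_class poly_class_linear.

Lemma poly_classZ c g : poly_class (c *: g) = c *: poly_class g.
Proof. exact: linearZ. Qed.

Lemma poly_class_eqP g h :
  poly_class g = poly_class h <->
  exists2 U : vfield, derivation f U = 0 & divergence U = g - h.
Proof.
have topB : top_form g - top_form h = top_form (g - h).
  by apply/ffunP=> L; rewrite !ffunE.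
have top0 : top_form 0 = 0 :> Defs.form K n n.+1.
  by apply/ffunP=> L; rewrite !ffunE.
split=> [/modquot_eqP|[U fU dU]].
  rewrite topB => /asboolP[u]; rewrite dfwedge_derivation -top0.
  move=> /top_form_inj fu; rewrite dform_divergence => /top_form_inj du.
  by exists (form_vfield u).
apply/modquot_eqP; rewrite topB; apply/asboolP; exists (vfield_form U).
  by rewrite dfwedge_derivation (eq_derivation (vfield_formK U)) fU top0.
by rewrite dform_divergence (eq_divergence (vfield_formK U)) dU.
Qed.

Hypothesis df_lreg : n = 0%N -> GRing.lreg (mderiv ord0 f).

Lemma derivation_eq0 (U : vfield) :
  n = 0%N -> derivation f U = 0 -> forall i, U i = 0.
Proof.
move=> n0 fU i.
have i0 (j : 'I_n.+1) : j = ord0.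
  by apply: val_inj; case: j => j /=; rewrite n0; case: j.
apply: (df_lreg n0).
rewrite mulr0 -fU /derivation (bigD1 i) //= (i0 i) big1 ?addr0 //.
by move=> j; rewrite (i0 j) eqxx.
Qed.

(** Any primitive without constant term computes [b]. The field of the chosen
    primitive of the chosen representative differs from [U] by a closed field,
    up to the field [Z] witnessing that the representative is in the class of
    [g]. *)
Lemma act_b_class g (U : vfield) :
    divergence U = g -> (forall i, (U i)@_0%MM = 0) ->
  act_b (poly_class g) = poly_class (derivation f U).
Proof.
move=> divU U0; rewrite /act_b.
have [g' reprE] := top_formP (repr (poly_class g)).
have /poly_class_eqP[Z fZ divZ] : poly_class g' = poly_class g.
  by rewrite /poly_class -reprE /brieskorn_class reprK.
rewrite reprE dfwedge_derivation.
set u := primitive _; set W := form_vfield u.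
have [du u0] : dform u = top_form g' /\ forall I, (u I)@_0%MM = 0.
  apply: (@classical_sets.xgetPex _ 0 (fun v : Defs.form K n n =>
    dform v = top_form g' /\ forall I, (v I)@_0%MM = 0)).
  exists (vfield_form (primitive_field iota g')); split.
    rewrite dform_divergence (eq_divergence (vfield_formK _)).
    by rewrite divergence_primitive_field.
  move=> I; rewrite ffunE raddf_sum big1 //= => i _.
  rewrite -signr_odd; case: odd; rewrite ?expr1 ?expr0 ?mulN1r ?mul1r ?mcoeffN.
    by rewrite mcoeff0_mulX oppr0.
  by rewrite mcoeff0_mulX.
have divW : divergence W = g'.
  by apply: top_form_inj; rewrite -dform_divergence.
have W0 i : (W i)@_0%MM = 0.
  rewrite /W /form_vfield /fcoef -signr_odd.
  case: insubP => [I _ _|_]; last by rewrite mulr0 mcoeff0.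
  by case: odd; rewrite ?expr1 ?expr0 ?mulN1r ?mul1r ?mcoeffN u0 ?oppr0.
have Z0 : n = 0%N -> forall i, Z i = 0 by move=> n0; apply: derivation_eq0.
apply/poly_class_eqP.
pose V1 i := -1 *: U i + W i; pose V2 i := -1 *: Z i + V1 i.
have divV : divergence V2 = 0.
  by rewrite !divergenceZD divU divW divZ !scaleN1r [- g + _]addrC addNr.
have V0 : n = 0%N -> forall i, (V2 i)@_0%MM = 0.
  by move=> n0 i; rewrite !mcoeffD !mcoeffZ Z0 // U0 W0 mcoeff0 !mulr0 !addr0.
have [Y fY divY] := derivation_closed iota f divV V0.
exists Y => //; rewrite divY !derivationZD fZ scaler0 add0r scaleN1r.
exact: addrC.
Qed.

Lemma act_a_class g : act_a (poly_class g) = poly_class (f * g).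
Proof.
rewrite /act_a; have [g' reprE] := top_formP (repr (poly_class g)).
have /poly_class_eqP[Z fZ divZ] : poly_class g' = poly_class g.
  by rewrite /poly_class -reprE /brieskorn_class reprK.
rewrite reprE; have -> : mulform f (top_form g') = top_form (f * g').
  by apply/ffunP=> L; rewrite !ffunE.
apply/poly_class_eqP; exists (fun i => f * Z i).
  rewrite -[RHS](mulr0 f) -fZ /derivation mulr_sumr.
  by apply: eq_bigr => i _; rewrite mulrCA.
rewrite /divergence; under eq_bigr => i _ do rewrite mderivM.
by rewrite big_split /= -/(derivation f Z) fZ add0r -mulr_sumr -mulrBr -divZ.
Qed.

Lemma act_a_linear : linear (@act_a K n f).
Proof.
move=> c x y; have [g ->] := poly_classP x; have [h ->] := poly_classP y.
rewrite -linearP !act_a_class -linearP; congr poly_class.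
by rewrite mulrDr -scalerAr.
Qed.

Lemma mcoeff0_primitive_field (g : poly) i :
  (primitive_field iota g i)@_0%MM = 0.
Proof. exact: mcoeff0_mulX. Qed.

Lemma act_b_primitive g :
  act_b (poly_class g) = poly_class (derivation f (primitive_field iota g)).
Proof.
apply: act_b_class; first exact: divergence_primitive_field.
exact: mcoeff0_primitive_field.
Qed.

Lemma act_b_linear : linear (@act_b K n f).
Proof.
move=> c x y; have [g ->] := poly_classP x; have [h ->] := poly_classP y.
rewrite -linearP !(act_b_primitive g, act_b_primitive h) -linearP -derivationZD.
apply: act_b_class; first by rewrite divergenceZD !divergence_primitive_field.
by move=> i; rewrite mcoeffD mcoeffZ !mcoeff0_primitive_field mulr0 addr0.
Qed.

(** If [g] has the primitive [U], then [f U] is a primitive of [f g] up to a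
    primitive [V] of [df /\ U]. *)
Lemma act_comm (x : brieskorn f) :
  act_a (act_b x) - act_b (act_a x) = act_b (act_b x).
Proof.
have [g ->] := poly_classP x; rewrite act_b_primitive !act_a_class.
set U := primitive_field iota g; set h := derivation f U.
rewrite (act_b_primitive h); set V := primitive_field iota h.
rewrite (@act_b_class (f * g) (fun i => -1 *: V i + f * U i)).
- rewrite derivationZD -linearB; congr poly_class.
  rewrite scaleN1r opprD opprK addrCA.
  rewrite [X in _ - X](_ : _ = f * h) ?subrr ?addr0 //.
  by rewrite /h /derivation mulr_sumr; apply: eq_bigr => i _; rewrite mulrCA.
- rewrite divergenceZD divergence_primitive_field scaleN1r /divergence.
  under eq_bigr => i _ do rewrite mderivM.
  rewrite big_split /= -/(derivation f U) addrA addNr add0r -mulr_sumr.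
  by rewrite -/(divergence U) divergence_primitive_field.
move=> i; rewrite mcoeffD mcoeffZ mcoeff0_primitive_field mulr0 add0r.
by rewrite rmorphM [X in _ * X]mcoeff0_primitive_field mulr0.
Qed.

End BrieskornOperators.

(** * Evaluating noncommutative polynomials in a and b *)

Section FreeAlgebraAction.
Import monalg.
Variables (C : fieldType) (K : comNzRingType) (iota : {rmorphism C -> K}).
Variables (E : lmodType K) (ua ub : {linear E -> E}).
Implicit Types (g h : freealg C) (x : E).

Lemma word_act_linear w : linear (word_act ua ub w).
Proof.
move=> c x y; rewrite /word_act.
elim: (w : seq bool) => //= l s ->.
by case: l; rewrite linearP.
Qed.

HB.instance Definition _ w :=
  GRing.isLinear.Build K E E _ (word_act ua ub w) (word_act_linear w).

Definition free_act g x : E :=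
  \sum_(w <- msupp g) iota (mcoeff w g) *: word_act ua ub w x.

Lemma free_actEw (d : {fset {fmonom bool}}) g x : (msupp g `<=` d)%fset ->
  free_act g x = \sum_(w <- d) iota (mcoeff w g) *: word_act ua ub w x.
Proof.
move=> le; rewrite /free_act (big_fset_incl _ le) //= => w _ /mcoeff_outdom ->.
by rewrite rmorph0 scale0r.
Qed.

Lemma free_actZD c g h x :
  free_act (c *: g + h) x = iota c *: free_act g x + free_act h x.
Proof.
pose d := (msupp g `|` msupp h `|` msupp (c *: g + h : freealg C)%R)%fset.
rewrite !(@free_actEw d);
  try by apply/fsubsetP=> w w_supp; rewrite !in_fsetU w_supp ?orbT.
rewrite scaler_sumr -big_split /=; apply: eq_bigr => w _.
by rewrite mcoeffD mcoeffZ rmorphD rmorphM /= scalerDl scalerA.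
Qed.

Lemma free_act_linear g : linear (free_act g).
Proof.
move=> c x y; rewrite /free_act scaler_sumr -big_split /=.
by apply: eq_bigr => w _; rewrite linearP /= scalerDr !scalerA mulrC.
Qed.

HB.instance Definition _ g :=
  GRing.isLinear.Build K E E _ (free_act g) (free_act_linear g).

Lemma free_actZr g c x : free_act g (c *: x) = c *: free_act g x.
Proof. exact: linearZ. Qed.

Lemma free_act0 x : free_act 0 x = 0.
Proof. by rewrite /free_act msupp0 big_seq_fset0. Qed.

Lemma free_actD g h x : free_act (g + h) x = free_act g x + free_act h x.
Proof. by have := free_actZD 1 g h x; rewrite rmorph1 !scale1r. Qed.

Lemma free_actZl c g x : free_act (c *: g) x = iota c *: free_act g x.
Proof. by rewrite -[c *: g]addr0 free_actZD free_act0 addr0. Qed.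

Lemma free_actB g h x : free_act (g - h) x = free_act g x - free_act h x.
Proof.
by have := free_actZD (-1) h g x; rewrite rmorphN1 !scaleN1r ![- _ + _]addrC.
Qed.

Lemma free_act_sum (T : Type) (s : seq T) (F : T -> freealg C) x :
  free_act (\sum_(i <- s) F i) x = \sum_(i <- s) free_act (F i) x.
Proof.
by apply: (big_morph (free_act ^~ x)) => [g h|]; rewrite ?free_actD ?free_act0.
Qed.

Lemma free_actU c w x :
  free_act << c *g w >> x = iota c *: word_act ua ub w x.
Proof.
rewrite (@free_actEw [fset w]%fset) ?msuppU_le // big_seq_fset1.
by rewrite mcoeffUU.
Qed.

Lemma free_actM g h x : free_act (g * h) x = free_act g (free_act h x).
Proof.
rewrite [g * h]malgME free_act_sum {2}/free_act.
apply: eq_bigr => v _.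
rewrite free_act_sum [in RHS]/free_act linear_sum scaler_sumr /=.
apply: eq_bigr => w _; rewrite free_actU rmorphM -scalerA [in RHS]linearZ /=.
by rewrite /word_act fmM foldr_cat.
Qed.

Lemma free_act1 x : free_act 1 x = x.
Proof.
rewrite -[1]/(mkmalgU (mone : {fmonom bool}) 1 : freealg C).
by rewrite free_actU rmorph1 scale1r /word_act fm1.
Qed.

Lemma free_act_a x : free_act (free_a C) x = ua x.
Proof. by rewrite free_actU rmorph1 scale1r /word_act fmU. Qed.

Lemma free_act_b x : free_act (free_b C) x = ub x.
Proof. by rewrite free_actU rmorph1 scale1r /word_act fmU. Qed.

Lemma free_act_factor c x :
  free_act (free_a C - c *: free_b C) x = ua x - iota c *: ub x.
Proof.
have actE g h : free_act (g - c *: h) x = free_act g x - iota c *: free_act h x.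
  by rewrite free_actB free_actZl.
by rewrite actE (free_act_a x) (free_act_b x).
Qed.

Lemma free_act_commrel x :
  free_act (commrel C) x = ua (ub x) - ub (ua x) - ub (ub x).
Proof.
rewrite -!free_act_b -!free_act_a.
have actE g h :
    free_act (g * h - h * g - h ^+ 2) x =
    free_act g (free_act h x) - free_act h (free_act g x) -
      free_act h (free_act h x).
  rewrite free_actB (free_actB (g * h)) expr2.
  by congr (_ - _ - _); exact: free_actM.
exact: actE.
Qed.

Hypothesis uab : forall x, ua (ub x) - ub (ua x) = ub (ub x).

Lemma free_act_ideal g x : g \in @commideal C -> free_act g x = 0.
Proof.
move=> /asboolP[s ->]; rewrite free_act_sum big1 // => u _.
rewrite -mulrA free_actM (free_actM (commrel C)) free_act_commrel.
by rewrite uab subrr linear0.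
Qed.

(** Two representatives differ by an element of the ideal of relations, which
    acts as zero: so the value may be computed on any representative. *)
Lemma ab_act_pi g x : ab_act iota ua ub (\pi_(abalg C) g) x = free_act g x.
Proof.
rewrite -[LHS]/(free_act _ x); apply/eqP; rewrite -subr_eq0 -free_actB.
by apply/eqP/free_act_ideal; exact: (@modquot_reprP _ _ (comm_submodule C)).
Qed.

End FreeAlgebraAction.

Section LinearProducts.
Import monalg.
Variable C : fieldType.

(** A lift to the free algebra; its monomials show the homogeneity. *)
Definition free_linear_product (s : seq rat) : freealg C :=
  \prod_(t <- s) (free_a C - ratr t *: free_b C).

Lemma free_linear_product_cons t s :
  free_linear_product (t :: s) =
  (free_a C - ratr t *: free_b C) * free_linear_product s.
Proof. by rewrite /free_linear_product big_cons. Qed.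

Lemma free_linear_productP (s : seq rat) :
  \pi_(abalg C) (free_linear_product s) =
  \prod_(t <- s) (ab_a C - ratr t *: ab_b C).
Proof.
rewrite /free_linear_product; elim: s => [|t s IHs]; first by rewrite !big_nil.
rewrite !big_cons -IHs -[LHS]abalg_piM; congr (_ * _).
by rewrite addrC -scaleNr modquot_piD -modquot_piZ addrC -scaleNr.
Qed.

Lemma homogeneous_linear_product (s : seq rat) :
  homogeneous (size s) (\pi_(abalg C) (free_linear_product s)).
Proof.
exists (free_linear_product s) => //; rewrite /free_linear_product.
elim: s => [|t s IHs] w /=.
  by rewrite big_nil mcoeff1; case: (w =P mone) => [->|_]; rewrite ?fdeg1 ?eqxx.
rewrite big_cons mcoeff_neq0 => /msuppM_le[v [u [v_supp u_supp ->]]].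
rewrite fdegM (IHs u) ?mcoeff_neq0 // -add1n; congr (_ + _)%N.
move: v_supp; rewrite -mcoeff_neq0 mcoeffB mcoeffZ !mcoeffU1.
case: (fmu true =P v) => [<-|_]; first by rewrite fdegU.
by case: (fmu false =P v) => [<-|_]; rewrite ?fdegU // mulr0 subrr eqxx.
Qed.
End LinearProducts.

(** * Linear algebra of the exponents *)

Section ExponentRelations.
Variables (n : nat) (alpha : 'I_n.+2 -> 'X_{1..n.+1}).
Hypothesis C2 : \rank (exponent_mx1 alpha) = n.+2.

Definition inv_exponent_mx1 : 'M[rat]_(n.+2, 1 + n.+1) :=
  invmx (exponent_mx1 alpha : 'M_n.+2).

(** Row [j] of the inverse matrix expresses the [j]-th term of [f] through [f]
    itself, with coefficient [a_coef j], and through the [x_i df/dx_i], with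
    coefficients [euler_coef j i]. *)
Definition a_coef (j : 'I_n.+2) : rat := inv_exponent_mx1 j (lshift n.+1 ord0).

Definition euler_coef (j : 'I_n.+2) (i : 'I_n.+1) : rat :=
  inv_exponent_mx1 j (rshift 1 i).

Lemma exponent_mx1_unit : (exponent_mx1 alpha : 'M_n.+2) \in unitmx.
Proof. by rewrite -row_free_unit /row_free [\rank _]C2. Qed.

Lemma exponent_mx10 i j : exponent_mx1 alpha (lshift n.+1 i) j = 1.
Proof. by rewrite col_mxEu mxE. Qed.

Lemma exponent_mx1S i j :
  exponent_mx1 alpha (rshift 1 i) j = (alpha j i)%:R.
Proof. by rewrite col_mxEd mxE. Qed.

Lemma exponent_inverse j k :
  a_coef j + \sum_i euler_coef j i * (alpha k i)%:R = (j == k)%:R.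
Proof.
have := congr1 (fun A : 'M_n.+2 => A j k) (mulVmx exponent_mx1_unit).
rewrite !mxE (@big_split_ord _ _ _ 1 n.+1) /= big_ord1 => <-.
congr (_ + _); first by rewrite exponent_mx10 mulr1.
by apply: eq_bigr => i _; rewrite exponent_mx1S.
Qed.

Lemma sum_a_coef : \sum_j a_coef j = 1.
Proof.
have := congr1 (fun A : 'M_n.+2 => A (lshift n.+1 ord0 : 'I_(1 + n.+1))
  (lshift n.+1 ord0 : 'I_(1 + n.+1))) (mulmxV exponent_mx1_unit).
rewrite !mxE eqxx => e; apply: etrans e; apply: eq_bigr => j _.
by rewrite exponent_mx10 mul1r.
Qed.

Lemma sum_a_coef_exponent i : \sum_j a_coef j * (alpha j i)%:R = 0.
Proof.
have := congr1 (fun A : 'M_n.+2 => A (rshift 1 i : 'I_(1 + n.+1))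
  (lshift n.+1 ord0 : 'I_(1 + n.+1))) (mulmxV exponent_mx1_unit).
rewrite !mxE => e; rewrite -[RHS]e; apply: eq_bigr => j _.
by rewrite exponent_mx1S mulrC.
Qed.

Lemma exponent_inj : injective alpha.
Proof.
move=> j k ajk; apply/eqP; have := exponent_inverse j k.
rewrite -ajk exponent_inverse eqxx => /eqP.
by case: (j == k) => //; rewrite oner_eq0.
Qed.

Hypothesis C1 : basis_of fullv (first_exponents alpha).

Lemma exponent_vec_max :
  exponent_vec alpha ord_max =
  \sum_k rho alpha k *: exponent_vec alpha (lift ord_max k).
Proof.
rewrite [LHS](coord_basis C1 (memvf _)); apply: eq_bigr => k _.
by rewrite -tnth_nth tnth_mktuple.
Qed.

Lemma exponent_maxE i :
  (alpha ord_max i)%:R =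
  \sum_k rho alpha k * (alpha (lift ord_max k) i)%:R :> rat.
Proof.
have := congr1 (fun v : 'cV_n.+1 => v i ord0) exponent_vec_max.
rewrite mxE summxE => ->; by apply: eq_bigr => k _; rewrite !mxE.
Qed.

(** The [a_coef] form a linear relation between all the exponents, and such
    relations are unique up to a factor because the first [n + 1] are free. *)
Lemma a_coef_lift k :
  a_coef (lift ord_max k) = - (rho alpha k * a_coef ord_max).
Proof.
have /freeP ind := basis_free C1.
pose c k := a_coef (lift ord_max k) + rho alpha k * a_coef ord_max.
suff /ind /(_ k) /eqP : \sum_(k < n.+1) c k *: (first_exponents alpha)`_k = 0.
  by rewrite addr_eq0 => /eqP.
apply/matrixP=> i j; rewrite summxE mxE ord1.
rewrite (eq_bigr (fun l => c l * (alpha (lift ord_max l) i)%:R)) => [|l _].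
  rewrite -[RHS](sum_a_coef_exponent i) [RHS](bigD1_ord ord_max) //=.
  rewrite exponent_maxE mulr_sumr -big_split /=.
  by apply: eq_bigr => l _; rewrite mulrDl addrC -mulrA mulrCA.
by rewrite -tnth_nth tnth_mktuple !mxE.
Qed.

Lemma a_coef_max_neq0 : a_coef ord_max != 0.
Proof.
apply/eqP=> s0; have := sum_a_coef.
rewrite (bigD1_ord ord_max) //= s0 big1 ?addr0 => [/eqP|k _].
  by rewrite eq_sym oner_eq0.
by rewrite a_coef_lift s0 mulr0 oppr0.
Qed.

(** This is what allows a linear factor [a - xi b] to be extracted from the
    multiplication by any term that occurs in the monomial relation. *)
Lemma a_coef_neq0 j : (lhs_exp alpha j != 0%N) || (rhs_exp alpha j != 0%N) ->
  a_coef j != 0.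
Proof.
rewrite /lhs_exp /rhs_exp; case: unliftP => [k|] ->.
  rewrite a_coef_lift oppr_eq0 mulf_eq0 negb_or a_coef_max_neq0 andbT.
  by case: (ltgtP (rho alpha k) 0).
by rewrite a_coef_max_neq0.
Qed.

Lemma pcoefE k : (pcoef alpha k)%:~R = (abs_r alpha)%:R * rho alpha k.
Proof.
rewrite /pcoef numqK // /abs_r; case: ex_minnP => N /andP[_ /forallP h] _.
exact: h.
Qed.

Lemma abs_r_gt0 : (0 < abs_r alpha)%N.
Proof. by rewrite /abs_r; case: ex_minnP => N /andP[]. Qed.

Lemma exp_diff k :
  (lhs_exp alpha (lift ord_max k))%:R - (rhs_exp alpha (lift ord_max k))%:R =
  - (abs_r alpha)%:R * rho alpha k :> rat.
Proof.
rewrite /lhs_exp /rhs_exp liftK mulNr -pcoefE.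
have r_gt0 : 0 < (abs_r alpha)%:R :> rat by rewrite ltr0n abs_r_gt0.
case: (ltgtP (rho alpha k) 0) => rho_k.
- rewrite subr0 natr_absz ltr0_norm ?mulrNz //.
  by rewrite -(ltr_int rat) pcoefE pmulr_rlt0.
- rewrite sub0r natr_absz gtr0_norm //.
  by rewrite -(ltr_int rat) pcoefE pmulr_rgt0.
by rewrite pcoefE rho_k mulr0 subr0 oppr0.
Qed.

Definition weighted_exponent (e : 'I_n.+2 -> nat) : 'X_{1..n.+1} :=
  (\sum_j alpha j *+ e j)%MM.

Lemma lhs_exp_max : lhs_exp alpha ord_max = abs_r alpha.
Proof. by rewrite /lhs_exp unlift_none. Qed.

Lemma rhs_exp_max : rhs_exp alpha ord_max = 0%N.
Proof. by rewrite /rhs_exp unlift_none. Qed.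

(** The monomial relation, without its powers of [lambda]: this is
    [alpha_(n+2) = sum_j rho_j alpha_j] multiplied by [|r|], with the negative
    coefficients moved to the other side. *)
Lemma weighted_exponent_eq :
  weighted_exponent (lhs_exp alpha) = weighted_exponent (rhs_exp alpha).
Proof.
apply/mnmP=> i; rewrite /weighted_exponent !mnm_sumE; apply/eqP.
rewrite -(eqr_nat rat) !natr_sum -subr_eq0 -sumrB (bigD1_ord ord_max) //=.
rewrite !mulmnE lhs_exp_max rhs_exp_max muln0 subr0 natrM exponent_maxE.
rewrite mulr_suml -big_split /= big1 // => k _.
by rewrite !mulmnE !natrM -mulrBr exp_diff mulNr mulrN
  [X in _ - X]mulrCA [X in _ - X]mulrC [X in _ - X * _]mulrC subrr.
Qed.

End ExponentRelations.

(** * Multiplying a monomial form by a product of terms *)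

Section Exponents.
Variables (n : nat) (alpha : 'I_n.+2 -> 'X_{1..n.+1}).

(** The indices of the terms to multiply by, with multiplicities, so that the
    factors can be produced one at a time. *)
Definition expand (e : 'I_n.+2 -> nat) : seq 'I_n.+2 :=
  flatten [seq nseq (e j) j | j <- enum 'I_n.+2].

Lemma size_expand e : size (expand e) = len e.
Proof.
rewrite size_flatten /shape -map_comp sumnE big_map big_enum /=.
by apply: eq_bigr => j _; rewrite size_nseq.
Qed.

Lemma mem_expand e j : j \in expand e -> e j != 0%N.
Proof.
by case/flatten_mapP=> k _; rewrite mem_nseq lt0n => /andP[ek /eqP->].
Qed.

Lemma prod_expand (R : comNzRingType) e (F : 'I_n.+2 -> R) :
  \prod_(j <- expand e) F j = \prod_j F j ^+ e j.
Proof.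
rewrite /expand big_flatten big_map big_enum /=; apply: eq_bigr => j _.
by rewrite big_nseq iter_mulr_1.
Qed.

(** The [xi] such that multiplying [x^gamma dx] by the [j]-th term acts as a
    multiple of [a - xi b], when [a_coef j] is not zero. *)
Definition factor_root (gamma : 'X_{1..n.+1}) (j : 'I_n.+2) : rat :=
  - (\sum_i euler_coef alpha j i * (gamma i).+1%:R) / a_coef alpha j.

(** The head of the list is multiplied last, so its exponent [gamma] contains
    all the other terms, and its linear factor is the leftmost one. *)
Fixpoint factor_roots (beta : 'X_{1..n.+1}) (js : seq 'I_n.+2) : seq rat :=
  if js is j :: js' then
    factor_root (beta + \sum_(k <- js') alpha k)%MM j :: factor_roots beta js'
  else [::].

Lemma size_factor_roots beta js : size (factor_roots beta js) = size js.
Proof. by elim: js => //= j js ->. Qed.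
End Exponents.

Section MonomialAction.
Variables (C : numFieldType) (K : idomainType) (iota : {rmorphism C -> K}).
Variables (n : nat) (alpha : 'I_n.+2 -> 'X_{1..n.+1}).
Hypothesis alpha_neq0 : forall j, alpha j != 0%MM.
Hypothesis C2 : \rank (exponent_mx1 alpha) = n.+2.
Variable lambda : K.
Local Notation f := (fpoly alpha lambda).

Definition coef (j : 'I_n.+2) : K := if j == ord_max then lambda else 1.
Definition term (j : 'I_n.+2) : {mpoly K[n.+1]} := coef j *: 'X_[alpha j].

Lemma fpolyE : f = \sum_j term j.
Proof.
rewrite (bigD1_ord ord_max) //= addrC /term /coef eqxx; congr (_ + _).
by apply: eq_bigr => j _; rewrite eq_sym (negPf (neq_lift _ _)) scale1r.
Qed.

Lemma mulX_mderiv_monomial i (m : 'X_{1..n.+1}) :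
  'X_i * mderiv i 'X_[m] = (m i)%:R *: 'X_[m] :> {mpoly K[n.+1]}.
Proof.
rewrite mderivX -scalerAr -mpolyXD.
case mi : (m i) => [|k]; first by rewrite !scale0r.
congr (_ *: 'X_[_]); apply/mnmP=> l; rewrite mnmDE mnmBE mnm1E.
by case: eqP => [<-|_]; rewrite ?mi ?subn0 // add1n subn1.
Qed.

Lemma euler_fpoly i : 'X_i * mderiv i f = \sum_j (alpha j i)%:R *: term j.
Proof.
rewrite fpolyE raddf_sum mulr_sumr; apply: eq_bigr => j _ /=.
by rewrite mderivZ -scalerAr mulX_mderiv_monomial scalerA mulrC -scalerA.
Qed.

(** In one variable, (C2) says that the two exponents differ, so the derivatives
    of the two terms cannot cancel. *)
Lemma fpoly_mderiv_lreg : n = 0%N -> GRing.lreg (mderiv ord0 f).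
Proof.
move=> n0; apply: mulfI; apply/eqP=> df0.
have := euler_fpoly ord0; rewrite df0 mulr0 => /(congr1 (mcoeff (alpha ord0))).
rewrite mcoeff0 raddf_sum (bigD1_ord ord0) //= big1 => [|j _]; last first.
  rewrite !mcoeffZ mcoeffX (inj_eq (exponent_inj C2)) eq_sym.
  by rewrite (negPf (neq_lift _ _)) !mulr0.
rewrite addr0 !mcoeffZ mcoeffX eqxx mulr1 /coef.
have -> : (ord0 == ord_max :> 'I_n.+2) = false by [].
rewrite mulr1 -(rmorph_nat iota) => /esym /eqP.
rewrite fmorph_eq0 pnatr_eq0 => /eqP a0; have /negP := alpha_neq0 ord0; apply.
apply/eqP/mnmP=> i; rewrite mnm0E -[RHS]a0; congr (alpha _ _).
by apply: val_inj; case: i => i /=; rewrite n0; case: i.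
Qed.

Let lreg := fpoly_mderiv_lreg.

(** The field [x_i x^gamma d/dx_i] has divergence [(gamma_i + 1) x^gamma]. *)
Lemma act_b_monomial (gamma : 'X_{1..n.+1}) i :
  (gamma i).+1%:R *: act_b (poly_class f 'X_[gamma]) =
  poly_class f ('X_i * mderiv i f * 'X_[gamma]).
Proof.
have bL := act_b_linear iota lreg.
have bZ c x : act_b (c *: x) = c *: act_b x :> brieskorn f.
  rewrite -[c *: x]addr0 bL.
  suff -> : @act_b K n f 0 = 0 by rewrite addr0.
  by have := bL (-1) 0 0; rewrite !scaleN1r oppr0 addr0 addNr.
rewrite -bZ -linearZ /=.
rewrite (act_b_class iota lreg
  (U := fun k => if k == i then 'X_i * 'X_[gamma] else 0)).
- rewrite /derivation (bigD1 i) //= eqxx big1 ?addr0 => [|k /negPf->].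
    by rewrite mulrA [mderiv _ _ * _]mulrC.
  by rewrite mulr0.
- rewrite /divergence (bigD1 i) //= eqxx big1 ?addr0 => [|k /negPf->].
    rewrite -mpolyXD mderivX mnmDE mnm1E eqxx add1n; congr (_ *: 'X_[_]).
    by rewrite addmC addmK.
  by rewrite mderiv0.
by move=> k; case: ifP => _; rewrite ?mcoeff0 ?mcoeff0_mulX.
Qed.

Local Notation "q %:K" := (iota (ratr q)) (at level 2, format "q %:K").

Lemma ratr_mulr p q : (p * q)%:K = p%:K * q%:K.
Proof. exact: (rmorphM (iota \o ratr)). Qed.

Lemma ratr_mulr_nat q m : (q * m%:R)%:K = q%:K * m%:R.
Proof. by rewrite ratr_mulr -[in RHS](rmorph_nat (iota \o ratr)). Qed.

(** The right-hand side is a combination of the classes of all the terms times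
    [x^gamma], whose coefficients are the entries of row [j] of the product of
    the inverse matrix by the matrix itself. *)
Lemma term_monomial_class j (gamma : 'X_{1..n.+1}) :
  poly_class f (term j * 'X_[gamma]) =
  (a_coef alpha j)%:K *: act_a (poly_class f 'X_[gamma]) +
  (\sum_i euler_coef alpha j i * (gamma i).+1%:R)%:K *:
     act_b (poly_class f 'X_[gamma]).
Proof.
rewrite act_a_class !rmorph_sum scaler_suml.
under [in RHS]eq_bigr => i _ do
  rewrite ratr_mulr_nat -scalerA act_b_monomial euler_fpoly mulr_suml
          linear_sum scaler_sumr /=.
have -> : poly_class f (f * 'X_[gamma]) =
    \sum_j poly_class f (term j * 'X_[gamma]).
  by rewrite -linear_sum -mulr_suml -fpolyE.
rewrite exchange_big /= scaler_sumr -big_split.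
rewrite (eq_bigr (fun k => (j == k)%:R *: poly_class f (term k * 'X_[gamma]))).
  rewrite (bigD1 j) //= eqxx scale1r big1 ?addr0 // => k.
  by rewrite eq_sym => /negPf->; rewrite scale0r.
move=> k _ /=; rewrite -(rmorph_nat (iota \o ratr)) -(exponent_inverse C2 j k).
rewrite rmorphD rmorph_sum scalerDl scaler_suml /=; congr (_ + _).
apply: eq_bigr => i _; rewrite ratr_mulr_nat -scalerA; congr (_ *: _).
by rewrite -scalerAl linearZ.
Qed.

Definition act_a_lin : {linear brieskorn f -> brieskorn f} :=
  HB.pack (@act_a K n f) (GRing.isLinear.Build _ _ _ _ _ (@act_a_linear K n f)).
Definition act_b_lin : {linear brieskorn f -> brieskorn f} :=
  HB.pack (@act_b K n f)
    (GRing.isLinear.Build _ _ _ _ _ (act_b_linear iota lreg)).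

Lemma brieskorn_act_pi g (x : brieskorn f) :
  brieskorn_act iota (\pi_(abalg C) g) x =
  free_act iota act_a_lin act_b_lin g x.
Proof.
exact: (@ab_act_pi _ _ iota _ act_a_lin act_b_lin (act_comm iota lreg)).
Qed.

Lemma brieskorn_actZD c P Q (x : brieskorn f) :
  brieskorn_act iota (c *: P + Q) x =
  iota c *: brieskorn_act iota P x + brieskorn_act iota Q x.
Proof.
elim/quotW: P => g; elim/quotW: Q => h.
have -> : c *: \pi_(abalg C) g + \pi_(abalg C) h = \pi_(abalg C) (c *: g + h).
  by rewrite modquot_piD -modquot_piZ.
rewrite (brieskorn_act_pi (c *: g + h)) (brieskorn_act_pi g).
by rewrite (brieskorn_act_pi h) free_actZD.
Qed.

Lemma brieskorn_actB P c Q (x : brieskorn f) :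
  brieskorn_act iota (P - c *: Q) x =
  brieskorn_act iota P x - iota c *: brieskorn_act iota Q x.
Proof. by rewrite addrC -scaleNr brieskorn_actZD rmorphN scaleNr addrC. Qed.

Lemma prod_termE js :
  \prod_(j <- js) term j =
  (\prod_(j <- js) coef j) *: 'X_[(\sum_(j <- js) alpha j)%MM].
Proof.
elim: js => [|j js IHs]; first by rewrite !big_nil scale1r mpolyX0.
by rewrite !big_cons IHs -scalerAl -scalerAr scalerA -mpolyXD.
Qed.

(** The scalar [c] carries the power of [lambda] accumulated by the terms
    already multiplied. *)
Lemma term_scaled_monomial_class j (gamma : 'X_{1..n.+1}) c :
    a_coef alpha j != 0 ->
  poly_class f (term j * (c *: 'X_[gamma])) =
  (a_coef alpha j)%:K *: free_act iota act_a_lin act_b_lin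
     (free_a C - ratr (factor_root alpha gamma j) *: free_b C)
     (poly_class f (c *: 'X_[gamma])).
Proof.
move=> aj_neq0.
have factor (E : lmodType K) (u v : E) p q xi : - (p * xi) = q ->
    c *: (p *: u + q *: v) = p *: (c *: (u - xi *: v)).
  move=> <-; rewrite [RHS]scalerA [p * c]mulrC -[RHS]scalerA scalerBr.
  by rewrite [p *: (xi *: v)]scalerA -scaleNr.
rewrite -scalerAr !poly_classZ term_monomial_class free_actZr.
rewrite free_act_factor; apply: factor.
rewrite -ratr_mulr -(rmorphN (iota \o ratr)) /factor_root.
by rewrite mulrCA divff // mulr1 opprK.
Qed.

Lemma prod_term_class beta js :
    all (fun j => a_coef alpha j != 0) js ->
  poly_class f (\prod_(j <- js) term j * 'X_[beta]) =
  (\prod_(j <- js) a_coef alpha j)%:K *: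
    brieskorn_act iota (\prod_(t <- factor_roots alpha beta js)
      (ab_a C - ratr t *: ab_b C)) (poly_class f 'X_[beta]).
Proof.
rewrite -free_linear_productP brieskorn_act_pi.
elim: js => [|j js IHs] /=.
  rewrite !big_nil mul1r !rmorph1 scale1r.
  by rewrite /free_linear_product big_nil free_act1.
case/andP=> aj_neq0 /IHs {}IHs.
set gamma := (beta + _)%MM.
have prodE : \prod_(k <- js) term k * 'X_[beta] =
    (\prod_(k <- js) coef k) *: 'X_[gamma].
  by rewrite prod_termE -scalerAl -mpolyXD addmC.
rewrite [\prod_(k <- _ :: _) term k]big_cons -mulrA prodE.
rewrite prodE in IHs; set p := _ *: _ in IHs *.
apply: (etrans (term_scaled_monomial_class gamma _ aj_neq0)).
rewrite -/p {}IHs {p} free_linear_product_cons.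
rewrite [\prod_(k <- _ :: _) a_coef _ k]big_cons.
rewrite ratr_mulr -[RHS]scalerA; apply: (congr1 ( *:%R _)).
by rewrite free_actZr; apply: (congr1 ( *:%R _)); exact/esym/free_actM.
Qed.

Lemma prod_coef_expand e : \prod_(j <- expand e) coef j = lambda ^+ e ord_max.
Proof.
rewrite prod_expand (bigD1_ord ord_max) //= /coef eqxx big1 ?mulr1 // => j _.
by rewrite eq_sym (negPf (neq_lift _ _)) expr1n.
Qed.

Hypothesis C1 : basis_of fullv (first_exponents alpha).

Lemma sum_expand e :
  (\sum_(j <- expand e) alpha j)%MM = weighted_exponent alpha e.
Proof.
rewrite /expand big_flatten big_map big_enum /=; apply: eq_bigr => j _.
rewrite big_nseq; elim: (e j) => [|k IHk]; first by rewrite mulm0n.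
by rewrite /= IHk mulmS.
Qed.

Lemma prod_term_lhs_rhs :
  \prod_(j <- expand (lhs_exp alpha)) term j =
  lambda ^+ abs_r alpha *: \prod_(j <- expand (rhs_exp alpha)) term j.
Proof.
rewrite !prod_termE !prod_coef_expand !sum_expand lhs_exp_max rhs_exp_max.
by rewrite scalerA mulr1 (weighted_exponent_eq C1).
Qed.

End MonomialAction.

(** * The relation between the two products *)

Section ProductOperators.
Variables (C : fieldType) (n : nat) (alpha : 'I_n.+2 -> 'X_{1..n.+1}).

Definition product_operator beta e : abalg C :=
  \prod_(t <- factor_roots alpha beta (expand e)) (ab_a C - ratr t *: ab_b C).

Lemma size_factor_roots_expand beta e :
  size (factor_roots alpha beta (expand e)) == len e.
Proof. by rewrite size_factor_roots size_expand. Qed.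

Lemma product_operator_linear beta e :
  linear_product (len e) (product_operator beta e).
Proof. by exists (Tuple (size_factor_roots_expand beta e)). Qed.

Lemma product_operator_homogeneous beta e :
  homogeneous (len e) (product_operator beta e).
Proof.
have /eqP <- := size_factor_roots_expand beta e.
rewrite /product_operator -free_linear_productP.
exact: homogeneous_linear_product.
Qed.

Definition product_scale e : rat := \prod_(j <- expand e) a_coef alpha j.

End ProductOperators.

Section TwoTermRelation.
Variables (C : numFieldType) (K : idomainType) (iota : {rmorphism C -> K}).
Variables (n : nat) (alpha : 'I_n.+2 -> 'X_{1..n.+1}).
Hypothesis alpha_neq0 : forall j, alpha j != 0%MM.
Hypothesis C2 : \rank (exponent_mx1 alpha) = n.+2.
Variables (lambda : K) (beta : 'X_{1..n.+1}).
Local Notation f := (fpoly alpha lambda).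
Local Notation w := (brieskorn_class f (monvol beta)).

Lemma scaler_rat_cancel (E : lmodType K) (x y : E) (k1 k2 : K) (p q : rat) :
    p != 0 ->
    k1 *: (iota (ratr p) *: x) = k2 *: (iota (ratr q) *: y) ->
  k1 *: x = (iota (ratr (q / p)) * k2) *: y.
Proof.
move=> p_neq0 eq_xy.
transitivity (iota (ratr p^-1) *: (k1 *: (iota (ratr p) *: x))).
  rewrite !scalerA mulrAC -ratr_mulr mulVf //.
  by rewrite [iota (ratr 1)](rmorph1 (iota \o ratr)) mul1r.
by rewrite eq_xy !scalerA mulrAC -ratr_mulr [p^-1 * q]mulrC.
Qed.

(** The scalars [k1] and [k2] leave room for the power of [lambda] on either
    side, according to the sign of [r]. *)
Lemma two_term_relation (e1 e2 : 'I_n.+2 -> nat) (k1 k2 : K) :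
    (forall j, e1 j != 0%N -> a_coef alpha j != 0) ->
    (forall j, e2 j != 0%N -> a_coef alpha j != 0) ->
    k1 *: \prod_(j <- expand e1) term alpha lambda j =
    k2 *: \prod_(j <- expand e2) term alpha lambda j ->
  k1 *: brieskorn_act iota (product_operator C alpha beta e1) w =
  (iota (ratr (product_scale alpha e2 / product_scale alpha e1)) * k2) *:
    brieskorn_act iota (product_operator C alpha beta e2) w.
Proof.
move=> a1 a2 eq12.
have all1 : all (fun j => a_coef alpha j != 0) (expand e1).
  by apply/allP=> j /mem_expand /a1.
have all2 : all (fun j => a_coef alpha j != 0) (expand e2).
  by apply/allP=> j /mem_expand /a2.
have scale_neq0 : product_scale alpha e1 != 0.
  by rewrite prodf_seq_neq0; apply/allP=> j /(allP all1).
have act1 := prod_term_class iota alpha_neq0 C2 lambda beta all1.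
have act2 := prod_term_class iota alpha_neq0 C2 lambda beta all2.
have class12 := congr1 (fun p => poly_class f (p * 'X_[beta])) eq12.
rewrite -!scalerAl !poly_classZ act1 act2 in class12.
exact: scaler_rat_cancel scale_neq0 class12.
Qed.

End TwoTermRelation.

Lemma len_Delta n (alpha : 'I_n.+2 -> 'X_{1..n.+1}) :
  len (Delta alpha) = (deg_d alpha + deg_h alpha)%N.
Proof.
rewrite /deg_d /deg_h subnKC // /Delta /delta /lhs_longer.
by case: ltnP => // /ltnW.
Qed.

Theorem theorem4p2p3 (R : realType) (n : nat)
    (alpha : 'I_n.+2 -> 'X_{1..n.+1})
    (alpha_neq0 : forall j, alpha j != 0%MM)
    (C1 : basis_of fullv (first_exponents alpha))
    (C2 : \rank (exponent_mx1 alpha) = n.+2)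
    (beta : 'X_{1..n.+1}) :
  exists (P Q : abalg R[i]) (c : rat),
    [/\ homogeneous (deg_d alpha + deg_h alpha) P /\
          linear_product (deg_d alpha + deg_h alpha) P,
        homogeneous (deg_d alpha) Q /\ linear_product (deg_d alpha) Q,
        c != 0,
        (* lambda a nonzero complex number *)
        (forall lambda : R[i], lambda != 0 ->
           let f : {mpoly R[i][n.+1]} := fpoly alpha lambda in
           brieskorn_act idfun (P - (ratr c * lambda ^ exp_r alpha) *: Q)
             (brieskorn_class f (monvol beta)) = 0) &
        (* lambda an indeterminate: E_f[lambda] over C[lambda], multiplied by
           lambda^|r| when r < 0 *)
        let f : {mpoly {poly R[i]}[n.+1]} := fpoly alpha 'X in
        let w := brieskorn_class f (monvol beta) in
        (0 < exp_r alpha ->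
           brieskorn_act polyC P w -
             ((ratr c)%:P * 'X^(`|exp_r alpha|%N)) *: brieskorn_act polyC Q w = 0) /\
        (exp_r alpha < 0 ->
           'X^(`|exp_r alpha|%N) *: brieskorn_act polyC P w -
             (ratr c)%:P *: brieskorn_act polyC Q w = 0)].
Proof.
have a_lhs j : lhs_exp alpha j != 0%N -> a_coef alpha j != 0.
  by move=> ej; apply: a_coef_neq0 => //; rewrite ej.
have a_rhs j : rhs_exp alpha j != 0%N -> a_coef alpha j != 0.
  by move=> ej; apply: a_coef_neq0 => //; rewrite ej orbT.
have a_Delta j : Delta alpha j != 0%N -> a_coef alpha j != 0.
  by rewrite /Delta; case: ifP => _ => [/a_lhs | /a_rhs].
have a_delta j : delta alpha j != 0%N -> a_coef alpha j != 0.
  by rewrite /delta; case: ifP => _ => [/a_rhs | /a_lhs].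
have scale_neq0 e : (forall j, e j != 0%N -> a_coef alpha j != 0) ->
    product_scale alpha e != 0.
  by move=> ae; rewrite prodf_seq_neq0; apply/allP=> j /mem_expand /ae.
exists (product_operator R[i] alpha beta (Delta alpha)).
exists (product_operator R[i] alpha beta (delta alpha)).
exists (product_scale alpha (delta alpha) / product_scale alpha (Delta alpha)).
rewrite -len_Delta; split.
- split; first exact: product_operator_homogeneous.
  exact: product_operator_linear.
- split; first exact: product_operator_homogeneous.
  exact: product_operator_linear.
- by rewrite mulf_neq0 ?invr_eq0 ?scale_neq0.
- move=> lambda lambda_neq0 f.
  apply: (etrans (brieskorn_actB idfun alpha_neq0 C2 _ _ _ _)).
  apply/eqP; rewrite subr_eq0 -[X in X == _]scale1r; apply/eqP.
  apply: (two_term_relation idfun alpha_neq0 C2 beta a_Delta a_delta).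
  have := prod_term_lhs_rhs lambda C1.
  rewrite /Delta /delta /exp_r scale1r; case: ifP => _ -> //.
  by rewrite scalerA -exprnN exprnP mulVf ?scale1r // expf_neq0.
have rel := prod_term_lhs_rhs ('X : {poly R[i]}) C1.
have r_gt0 := abs_r_gt0 alpha.
split; rewrite /exp_r.
- case: ifP => longer; last by rewrite oppr_gt0 (ltz_nat _ 0) ltn0.
  move=> _; apply/eqP; rewrite subr_eq0 -[X in X == _]scale1r; apply/eqP.
  apply: (two_term_relation polyC alpha_neq0 C2 beta a_Delta a_delta).
  by rewrite /Delta /delta longer scale1r rel.
case: ifP => longer; first by rewrite (ltz_nat _ 0) ltn0.
move=> _; apply/eqP; rewrite subr_eq0 -[(ratr _)%:P]mulr1; apply/eqP.
apply: (two_term_relation polyC alpha_neq0 C2 beta a_Delta a_delta).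
by rewrite /Delta /delta longer scale1r rel abszN.
Qed.
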